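(* Let $G$ be a finite group, $k$ a field in which $|G|$ is invertible, and $\omega:G\times G\times G\to k^\times$ a normalized $3$-cocycle. Let $H=D^\omega(G)$ be the twisted quantum double of $G$ over $k$. Then for any irreducible character $\chi$ of $D^\omega(G)$, the Frobenius-Schur indicator $\chi(\nu_{D^\omega(G)})$ is given by Bantay's formula $$\chi(\nu_{D^\omega(G)})=|G|^{-1}\sum_{\substack{g,x\in G\\ x^{-1}gx=g^{-1}}}\omega(g^{-1},g,g^{-1})\,\gamma_x(g,g^{-1})\,\theta_g(x,x)\,\chi(e(g)\otimes x^2).$$
   Context: A normalized $3$-cocycle is a function $\omega:G^3\to k^\times$ with $\omega(x,y,z)=1$ whenever one of $x,y,z$ is the identity, and $\omega(g,x,y)\omega(g,xy,z)\omega(x,y,z)=\omega(gx,y,z)\omega(g,x,yz)$ for all $g,x,y,z\in G$. For $g\in G$ put $$\theta_g(x,y)=\frac{\omega(g,x,y)\,\omega(x,y,(xy)^{-1}gxy)}{\omega(x,x^{-1}gx,y)},\qquad \gamma_g(x,y)=\frac{\omega(x,y,g)\,\omega(g,g^{-1}xg,g^{-1}yg)}{\omega(x,g,g^{-1}yg)}.$$ $D^\omega(G)$ is the quasi-Hopf algebra with underlying space $k[G]'\otimes k[G]$ with basis $e(g)\otimes x$ ($g,x\in G$; $\{e(g)\}$ the basis of the linear dual $k[G]'$ dual to $G$) and structure: $(e(g)\otimes x)(e(h)\otimes y)=\theta_g(x,y)\,\delta_{g,xhx^{-1}}\,e(g)\otimes xy$; $\Delta(e(g)\otimes x)=\sum_{hk=g}\gamma_x(h,k)\,e(h)\otimes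 x\otimes e(k)\otimes x$; $\Phi=\sum_{g,h,k}\omega(g,h,k)^{-1}e(g)\otimes1\otimes e(h)\otimes1\otimes e(k)\otimes1$; $\varepsilon(e(g)\otimes x)=\delta_{g,1}$; $S(e(g)\otimes x)=\theta_{g^{-1}}(x,x^{-1})^{-1}\gamma_x(g,g^{-1})^{-1}e(x^{-1}g^{-1}x)\otimes x^{-1}$; $\alpha=1$; $\beta=\sum_{g}\omega(g,g^{-1},g)\,e(g)\otimes1$. It is a semi-simple algebra. For a finite-dimensional semi-simple quasi-Hopf algebra $(H,\Delta,\varepsilon,\Phi,\alpha,\beta,S)$ write $\Phi=\sum X_i\otimes Y_i\otimes Z_i$, $\Phi^{-1}=\sum\overline X_i\otimes\overline Y_i\otimes\overline Z_i$, $q_L=\sum S(\overline X_i)\alpha\overline Y_i\otimes\overline Z_i$, $p_L=\sum Y_iS^{-1}(X_i\beta)\otimes Z_i$. There is a unique $\Lambda\in H$ with $h\Lambda=\varepsilon(h)\Lambda=\Lambda h$ for all $h\in H$ and $\varepsilon(\Lambda)=1$ (the normalized two-sided integral). Define $\nu_H=m(q_L\Delta(\Lambda)p_L)$, $m$ being multiplication in $H$. The Frobenius-Schur indicator of an irreducible character $\chi$ of $H$ is $\chi(\nu_H)$. *)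

(* Defs.v *)
From HB Require Import structures.
From mathcomp Require Import all_boot all_order all_fingroup all_algebra all_field.
From mathcomp Require Import ring.
From Stdlib Require Import ClassicalEpsilon.

Set Implicit Arguments.
Unset Strict Implicit.
Unset Printing Implicit Defensive.

Import GRing.Theory.
Local Open Scope ring_scope.

(** * Tensor products of finite-dimensional vector spaces *)

(** [V (x) W] is realized as the space of [dim V] by [dim W] matrices, [v (x) w]
    being the matrix of the products of the coordinates of [v] and [w] in the
    bases [vbasis {:V}] and [vbasis {:W}]. Lemmas [bilin_tens], [tlift_tens] and
    [tensor_ind] below are its universal property. *)
Definition tensor (k : fieldType) (V W : vectType k) : Type :=
  'M[k]_(\dim {:V}, \dim {:W}).

HB.instance Definition _ (k : fieldType) (V W : vectType k) :=
  Vector.on (tensor V W).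

Notation "V \otimes W" := (tensor V W)
  (at level 40, left associativity) : type_scope.

Section Tensor.
Variable k : fieldType.

Definition tens (V W : vectType k) (v : V) (w : W) : V \otimes W :=
  \matrix_(i, j) (coord (vbasis {:V}) i v * coord (vbasis {:W}) j w).

Definition bilin (V W U : vectType k) (f : V -> W -> U) :=
  (forall w, linear (f^~ w)) /\ (forall v, linear (f v)).

(** The linear map [V (x) W -> U] induced by a bilinear map [f]; it is only
    meaningful when [f] is bilinear. *)
Definition tlift (V W U : vectType k) (f : V -> W -> U) (t : V \otimes W) : U :=
  \sum_i \sum_j (t : 'M_(_, _)) i j *:
     f (vbasis {:V})`_i (vbasis {:W})`_j.

End Tensor.

Notation "v \ot w" := (tens v w)
  (at level 40, left associativity) : ring_scope.

Section TensorTheory.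
Variable k : fieldType.

Lemma tensE (V W : vectType k) (v : V) (w : W) i j :
  (v \ot w : 'M_(_, _)) i j = coord (vbasis {:V}) i v * coord (vbasis {:W}) j w.
Proof. exact: mxE. Qed.

Lemma bilin_tens (V W : vectType k) : bilin (@tens k V W).
Proof.
split=> [w a u v|v a u w]; apply/matrixP=> i j;
  by rewrite !(mxE, tensE) linearP /=; ring.
Qed.

Lemma tlift_is_linear (V W U : vectType k) (f : V -> W -> U) : linear (tlift f).
Proof.
move=> a s t; rewrite /tlift scaler_sumr -big_split /=; apply: eq_bigr => i _.
rewrite scaler_sumr -big_split /=; apply: eq_bigr => j _.
by rewrite !mxE scalerDl scalerA.
Qed.
HB.instance Definition _ (V W U : vectType k) (f : V -> W -> U) :=
  GRing.isLinear.Build k (V \otimes W) U _ (tlift f) (tlift_is_linear f).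

Lemma basis_sum (V : vectType k) (v : V) :
  v = \sum_i coord (vbasis {:V}) i v *: (vbasis {:V})`_i.
Proof. exact: coord_vbasis (memvf v). Qed.

Lemma coord_nth (V : vectType k) (i j : 'I_(\dim {:V})) :
  coord (vbasis {:V}) i (vbasis {:V})`_j = (i == j)%:R.
Proof. by rewrite coord_free; [rewrite eq_sym|apply: basis_free (vbasisP _)]. Qed.

Lemma linear_sumZ (V U : vectType k) (f : V -> U) (I : finType)
  (c : I -> k) (v : I -> V) : linear f ->
  f (\sum_i c i *: v i) = \sum_i c i *: f (v i).
Proof.
move=> lf; pose F := GRing.isLinear.Build k V U _ f lf.
pose g : {linear V -> U} := HB.pack f F.
rewrite -[f]/(g : V -> U) linear_sum.
by apply: eq_bigr => i _; rewrite linearZ.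
Qed.

Lemma tlift_tens (V W U : vectType k) (f : V -> W -> U) v w :
  bilin f -> tlift f (v \ot w) = f v w.
Proof.
case=> fl fr; rewrite [in RHS](basis_sum v).
rewrite (linear_sumZ (f := f^~ w)) //; apply: eq_bigr => i _.
rewrite [in RHS](basis_sum w) linear_sumZ // scaler_sumr.
by apply: eq_bigr => j _; rewrite tensE scalerA.
Qed.

Lemma tensor_sum (V W : vectType k) (t : V \otimes W) : t = tlift (@tens k V W) t.
Proof.
apply/matrixP=> i j; rewrite /tlift summxE (bigD1 i) //= summxE (bigD1 j) //=.
rewrite !(mxE, tensE) !coord_nth !eqxx !mulr1 big1 => [|j' ne]; last first.
  by rewrite !(mxE, tensE) !coord_nth [j == _]eq_sym (negPf ne) !mulr0.
rewrite big1 ?addr0 // => i' ne; rewrite summxE big1 // => j' _.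
by rewrite !(mxE, tensE) !coord_nth [i == _]eq_sym (negPf ne) mul0r mulr0.
Qed.

Lemma tensor_ind (V W : vectType k) (P : V \otimes W -> Prop) :
  P 0 -> (forall s t, P s -> P t -> P (s + t)) -> (forall v w, P (v \ot w)) ->
  forall t, P t.
Proof.
move=> P0 PD Pt t; rewrite (tensor_sum t) /tlift.
elim/big_ind: _ => // i _; elim/big_ind: _ => // j _.
set v := _`_i; set w := _`_j; set c := _ i j.
suff -> : c *: (v \ot w) = (c *: v) \ot w by [].
by apply/matrixP=> i' j'; rewrite !(mxE, tensE) linearZ mulrA.
Qed.

Lemma tensor_ext (V W U : vectType k) (f g : {linear V \otimes W -> U}) :
  (forall v w, f (v \ot w) = g (v \ot w)) -> f =1 g.
Proof.
move=> fg; elim/tensor_ind => [|s t es et|//]; first by rewrite !linear0.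
by rewrite !linearD es et.
Qed.

Lemma coord_eq0 (V : vectType k) (v : V) :
  v != 0 -> exists i, coord (vbasis {:V}) i v != 0.
Proof.
move=> nv; apply/existsP; apply: contraNT nv; rewrite negb_exists => /forallP h.
by rewrite [v]basis_sum big1 // => i _; move: (h i); rewrite negbK => /eqP->;
  rewrite scale0r.
Qed.

Lemma tens_neq0 (V W : vectType k) (v : V) (w : W) :
  v != 0 -> w != 0 -> v \ot w != 0.
Proof.
case/coord_eq0=> i vi /coord_eq0[j wj]; apply/eqP=> /matrixP/(_ i j)/eqP.
by rewrite !(mxE, tensE) mulf_eq0 (negPf vi) (negPf wj).
Qed.

End TensorTheory.

(** The associativity isomorphism [V (x) (W (x) U) -> (V (x) W) (x) U]. *)
Definition tassoc (k : fieldType) (V W U : vectType k) :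
    V \otimes (W \otimes U) -> V \otimes W \otimes U :=
  tlift (fun v => tlift (fun w u => v \ot w \ot u)).

Definition tmap (k : fieldType) (V V' W W' : vectType k)
    (f : V -> V') (g : W -> W') : V \otimes W -> V' \otimes W' :=
  tlift (fun v w => f v \ot g w).

Definition tlift3 (k : fieldType) (V1 V2 V3 U : vectType k)
    (f : V1 -> V2 -> V3 -> U) : V1 \otimes V2 \otimes V3 -> U :=
  tlift (fun t v3 => tlift (fun v1 v2 => f v1 v2 v3) t).

Section TensorAlgebra.
Variable k : fieldType.

Lemma tens_linl (V W : vectType k) c (v v' : V) (w : W) :
  (c *: v + v') \ot w = c *: (v \ot w) + v' \ot w.
Proof. exact: (bilin_tens V W).1. Qed.

Lemma tens_linr (V W : vectType k) c (v : V) (w w' : W) :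
  v \ot (c *: w + w') = c *: (v \ot w) + v \ot w'.
Proof. exact: (bilin_tens V W).2. Qed.

Lemma tlift_linf (V W U : vectType k) c (f g h : V -> W -> U) (t : V \otimes W) :
  (forall v w, f v w = c *: g v w + h v w) ->
  tlift f t = c *: tlift g t + tlift h t.
Proof.
move=> fE; rewrite /tlift scaler_sumr -big_split; apply: eq_bigr => i _ /=.
rewrite scaler_sumr -big_split; apply: eq_bigr => j _ /=.
by rewrite fE scalerDr !scalerA mulrC.
Qed.

Variables A B : falgType k.
Implicit Types s t : A \otimes B.

Definition tmul s t : A \otimes B :=
  tlift (fun a b => tlift (fun c d => (a * c) \ot (b * d)) t) s.

Lemma tmul_tens (a c : A) (b d : B) :
  tmul (a \ot b) (c \ot d) = (a * c) \ot (b * d).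
Proof.
have bi a' b' : bilin (fun (c : A) (d : B) => (a' * c) \ot (b' * d)).
  by split=> [y e u v|y e u v]; rewrite mulrDr -scalerAr (tens_linl, tens_linr).
rewrite /tmul tlift_tens ?tlift_tens //.
split=> [y e u v|y e u v]; apply: tlift_linf => p q;
  by rewrite mulrDl -scalerAl (tens_linl, tens_linr).
Qed.

Lemma tmul_linl t : linear (tmul^~ t).
Proof. by move=> c u v; rewrite /tmul linearP. Qed.

Lemma tmul_linr s : linear (tmul s).
Proof. by move=> c u v; apply: tlift_linf => p q; rewrite linearP. Qed.

Let tmulDl : left_distributive tmul +%R.
Proof. by move=> s t u; have:= tmul_linl u 1 s t; rewrite /= !scale1r. Qed.
Let tmulDr : right_distributive tmul +%R.
Proof. by move=> s t u; have:= tmul_linr s 1 t u; rewrite /= !scale1r. Qed.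
Let tmul0l t : tmul 0 t = 0.
Proof. by rewrite /tmul linear0. Qed.
Let tmul0r t : tmul t 0 = 0.
Proof. by apply: (addrI (tmul t 0)); rewrite -tmulDr !addr0. Qed.
Let tmulZl c s t : c *: tmul s t = tmul (c *: s) t.
Proof. by have:= tmul_linl t c s 0; rewrite !addr0 /= tmul0l addr0. Qed.
Let tmulZr c s t : c *: tmul s t = tmul s (c *: t).
Proof. by have:= tmul_linr s c t 0; rewrite !addr0 /= tmul0r addr0. Qed.

Let tmulA : associative tmul.
Proof.
move=> s t u; elim/tensor_ind: s => [|s s' IH IH'|a b].
- by rewrite !tmul0l.
- by rewrite !tmulDl IH IH'.
elim/tensor_ind: t => [|t t' IH IH'|c d].
- by rewrite !(tmul0l, tmul0r).
- by rewrite !(tmulDl, tmulDr) IH IH'.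
elim/tensor_ind: u => [|u u' IH IH'|e f].
- by rewrite !(tmul0l, tmul0r).
- by rewrite !(tmulDl, tmulDr) IH IH'.
by rewrite !tmul_tens !mulrA.
Qed.

Let tmul1l : left_id (1 \ot 1) tmul.
Proof.
elim/tensor_ind => [|t t' IH IH'|c d]; first by rewrite tmul0r.
  by rewrite tmulDr IH IH'.
by rewrite tmul_tens !mul1r.
Qed.

Let tmul1r : right_id (1 \ot 1) tmul.
Proof.
elim/tensor_ind => [|t t' IH IH'|c d]; first by rewrite tmul0l.
  by rewrite tmulDl IH IH'.
by rewrite tmul_tens !mulr1.
Qed.

Let tone_neq0 : (1 : A) \ot (1 : B) != 0.
Proof. by apply: tens_neq0; apply: oner_neq0. Qed.

HB.instance Definition _ := GRing.Zmodule_isNzRing.Build (A \otimes B)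
  tmulA tmul1l tmul1r tmulDl tmulDr tone_neq0.
HB.instance Definition _ :=
  GRing.Lmodule_isLalgebra.Build k (A \otimes B) tmulZl.
HB.instance Definition _ :=
  GRing.Lalgebra_isAlgebra.Build k (A \otimes B) tmulZr.
HB.instance Definition _ := Algebra_isFalgebra.Build k (A \otimes B).

Lemma tensM (a c : A) (b d : B) : (a \ot b) * (c \ot d) = (a * c) \ot (b * d).
Proof. exact: tmul_tens. Qed.

Lemma tens1 : (1 : A) \ot (1 : B) = 1.
Proof. by []. Qed.

End TensorAlgebra.

Section TensorMaps.
Variable k : fieldType.

Lemma bilinP (V W U : vectType k) (f : V -> W -> U) :
  (forall w, linear (f^~ w)) -> (forall v, linear (f v)) -> bilin f.
Proof. by []. Qed.

Lemma tassoc_is_linear (V W U : vectType k) : linear (@tassoc k V W U).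
Proof. exact: tlift_is_linear. Qed.
HB.instance Definition _ (V W U : vectType k) :=
  GRing.isLinear.Build k (V \otimes (W \otimes U)) (V \otimes W \otimes U) _
    (@tassoc k V W U) (@tassoc_is_linear V W U).

Lemma tmap_is_linear (V V' W W' : vectType k) (f : V -> V') (g : W -> W') :
  linear (tmap f g).
Proof. exact: tlift_is_linear. Qed.
HB.instance Definition _ (V V' W W' : vectType k) (f : V -> V') (g : W -> W') :=
  GRing.isLinear.Build k (V \otimes W) (V' \otimes W') _ (tmap f g)
    (tmap_is_linear f g).

Lemma tlift3_is_linear (V1 V2 V3 U : vectType k) (f : V1 -> V2 -> V3 -> U) :
  linear (tlift3 f).
Proof. exact: tlift_is_linear. Qed.
HB.instance Definition _ (V1 V2 V3 U : vectType k) (f : V1 -> V2 -> V3 -> U) :=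
  GRing.isLinear.Build k (V1 \otimes V2 \otimes V3) U _ (tlift3 f)
    (tlift3_is_linear f).

Lemma tmap_tens (V V' W W' : vectType k) (f : V -> V') (g : W -> W') v w :
  linear f -> linear g -> tmap f g (v \ot w) = f v \ot g w.
Proof.
move=> lf lg; rewrite /tmap tlift_tens //; split=> [y c a b|y c a b].
  by rewrite lf tens_linl.
by rewrite lg tens_linr.
Qed.

Lemma tassoc_tens (V W U : vectType k) (v : V) (w : W) (u : U) :
  tassoc (v \ot (w \ot u)) = v \ot w \ot u.
Proof.
have bi v' : bilin (fun (w : W) (u : U) => v' \ot w \ot u).
  split=> [y c a b|y c a b]; last by rewrite tens_linr.
  by rewrite tens_linr tens_linl.
rewrite /tassoc tlift_tens ?tlift_tens //.
split=> [y c a b|y c a b]; last by rewrite linearP.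
by apply: tlift_linf => p q; rewrite !tens_linl.
Qed.

Lemma tlift3_tens (V1 V2 V3 U : vectType k) (f : V1 -> V2 -> V3 -> U) v1 v2 v3 :
  (forall b c, linear (fun a => f a b c)) ->
  (forall a c, linear (fun b => f a b c)) ->
  (forall a b, linear (fun c => f a b c)) ->
  tlift3 f (v1 \ot v2 \ot v3) = f v1 v2 v3.
Proof.
move=> l1 l2 l3; rewrite /tlift3 tlift_tens; last first.
  split=> [y c a b|y c a b]; first by rewrite linearP.
  by apply: tlift_linf => p q; exact: (l3 p q c a b).
by rewrite tlift_tens.
Qed.

Lemma tensZl (V W : vectType k) c (v : V) (w : W) : (c *: v) \ot w = c *: (v \ot w).
Proof. by apply/matrixP=> i j; rewrite !(tensE, mxE) linearZ mulrA. Qed.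

Lemma tensZr (V W : vectType k) c (v : V) (w : W) : v \ot (c *: w) = c *: (v \ot w).
Proof. by apply/matrixP=> i j; rewrite !(tensE, mxE) linearZ mulrCA. Qed.

Lemma tensDl (V W : vectType k) (v v' : V) (w : W) :
  (v + v') \ot w = v \ot w + v' \ot w.
Proof. by rewrite -[v]scale1r tens_linl !scale1r. Qed.

Lemma tensDr (V W : vectType k) (v : V) (w w' : W) :
  v \ot (w + w') = v \ot w + v \ot w'.
Proof. by rewrite -[w]scale1r tens_linr !scale1r. Qed.

Lemma tens0l (V W : vectType k) (w : W) : (0 : V) \ot w = 0.
Proof. by rewrite -(scale0r (0 : V)) tensZl scale0r. Qed.

Lemma tens0r (V W : vectType k) (v : V) : v \ot (0 : W) = 0.
Proof. by rewrite -(scale0r (0 : W)) tensZr scale0r. Qed.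

Lemma tens_suml (V W : vectType k) (I : finType) (P : pred I) (F : I -> V) (w : W) :
  (\sum_(i | P i) F i) \ot w = \sum_(i | P i) F i \ot w.
Proof.
by apply: (big_morph (fun v => v \ot w)) => [x y|]; rewrite ?tensDl ?tens0l.
Qed.

Lemma tens_sumr (V W : vectType k) (I : finType) (P : pred I) (v : V) (F : I -> W) :
  v \ot (\sum_(i | P i) F i) = \sum_(i | P i) v \ot F i.
Proof.
by apply: (big_morph (tens v)) => [x y|]; rewrite ?tensDr ?tens0r.
Qed.

End TensorMaps.

(** * Quasi-Hopf algebras *)

(** Drinfeld's axioms for a quasi-Hopf algebra structure on the
    finite-dimensional algebra [H]. [H (x) H (x) H] is bracketed to the left,
    hence the occurrences of [tassoc]. *)
Record quasiHopf (k : fieldType) (H : falgType k) := QuasiHopf {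
  comult : {lrmorphism H -> H \otimes H};
  counit : {lrmorphism H -> k^o};
  associator : H \otimes H \otimes H;
  alpha : H;
  beta : H;
  antipode : 'End(H);
  counitl : forall h, tlift (fun a b => (counit a : k) *: b) (comult h) = h;
  counitr : forall h, tlift (fun a b => (counit b : k) *: a) (comult h) = h;
  associator_unit : associator \is a GRing.unit;
  quasi_coassoc : forall h,
    tassoc (tmap idfun comult (comult h)) * associator
      = associator * tmap comult idfun (comult h);
  pentagon :
    tassoc (tmap idfun comult associator)
        * tmap (tmap comult idfun) idfun associator
      = tmap (@tassoc k H H H) idfun (tassoc ((1 : H) \ot associator))
        * tmap (fun t => tassoc (tmap idfun comult t)) idfun associator
        * (associator \ot (1 : H));
  associator_counit :
    tlift3 (fun a b c => (counit b : k) *: (a \ot c)) associator = 1;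
  antipode1 : antipode 1 = 1;
  antipodeM : forall a b, antipode (a * b) = antipode b * antipode a;
  antipode_bij : bijective antipode;
  antipodel : forall h,
    tlift (fun a b => antipode a * alpha * b) (comult h)
      = (counit h : k) *: alpha;
  antipoder : forall h,
    tlift (fun a b => a * beta * antipode b) (comult h)
      = (counit h : k) *: beta;
  antipode_associator :
    tlift3 (fun x y z => x * beta * antipode y * alpha * z) associator = 1;
  antipode_associatorV :
    tlift3 (fun x y z => antipode x * alpha * y * beta * antipode z)
      associator^-1 = 1 }.

Section Indicator.
Variables (k : fieldType) (H : falgType k) (Q : quasiHopf H).

Definition normalized_integral (L : H) : Prop :=
  [/\ forall h, h * L = (counit Q h : k) *: L,
      forall h, L * h = (counit Q h : k) *: L
    & counit Q L = 1].

Lemma normalized_integral_uniq (L L' : H) :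
  normalized_integral L -> normalized_integral L' -> L = L'.
Proof.
case=> _ Lr eL [L'l _ eL'].
by rewrite -[LHS]scale1r -[X in X *: _]eL' -Lr L'l eL scale1r.
Qed.

(** The normalized two-sided integral: it is unique by the previous lemma, and
    exists when [H] is semisimple. *)
Definition integral : H := epsilon (inhabits 0) normalized_integral.

Definition q_L : H \otimes H :=
  tlift3 (fun x y z => (antipode Q x * alpha Q * y) \ot z) (associator Q)^-1.

Definition p_L : H \otimes H :=
  tlift3 (fun x y z => (y * ((antipode Q)^-1)%VF (x * beta Q)) \ot z)
    (associator Q).

Definition FS_nu : H := tlift *%R (q_L * comult Q integral * p_L).

End Indicator.

(** * Irreducible characters *)

(** The column space ['cV[k]_n.+1], with [H] acting through [rho], is a simple
    left [H]-module. *)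
Definition irreducible_repr (k : fieldType) (H : falgType k) (n : nat)
    (rho : {lrmorphism H -> 'M[k]_n.+1}) : Prop :=
  forall U : {vspace 'cV[k]_n.+1},
    (forall (h : H) (u : 'cV[k]_n.+1), u \in U -> rho h *m u \in U) ->
    U = 0%VS \/ U = fullv.

Definition irreducible_character (k : fieldType) (H : falgType k)
    (chi : H -> k) : Prop :=
  exists (n : nat) (rho : {lrmorphism H -> 'M[k]_n.+1}),
    irreducible_repr rho /\ (forall h, chi h = \tr (rho h)).

(** * The twisted quantum double *)

Record cocycle3 (gT : finGroupType) (k : fieldType) := Cocycle3 {
  cocycle3_fun :> gT -> gT -> gT -> k;
  cocycle3_neq0 : forall x y z, cocycle3_fun x y z != 0;
  cocycle3_norm : forall x y z,
    [\/ x = 1%g, y = 1%g | z = 1%g] -> cocycle3_fun x y z = 1;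
  cocycle3E : forall g x y z,
    cocycle3_fun g x y * cocycle3_fun g (x * y)%g z * cocycle3_fun x y z
      = cocycle3_fun (g * x)%g y z * cocycle3_fun g x (y * z)%g }.

Definition theta (gT : finGroupType) (k : fieldType) (w : cocycle3 gT k)
    (g x y : gT) : k :=
  w g x y * w x y ((x * y)^-1 * g * (x * y))%g / w x (x^-1 * g * x)%g y.

Definition gamma (gT : finGroupType) (k : fieldType) (w : cocycle3 gT k)
    (g x y : gT) : k :=
  w x y g * w g (g^-1 * x * g)%g (g^-1 * y * g)%g / w x g (g^-1 * y * g)%g.

Section Scalars.
Variables (gT : finGroupType) (k : fieldType) (w : cocycle3 gT k).
Implicit Types g h x y z : gT.

Let w0 x y z : w x y z != 0. Proof. exact: cocycle3_neq0. Qed.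
Let w1xx x y : w 1%g x y = 1. Proof. by apply: cocycle3_norm; apply: Or31. Qed.
Let wx1x x y : w x 1%g y = 1. Proof. by apply: cocycle3_norm; apply: Or32. Qed.
Let wxx1 x y : w x y 1%g = 1. Proof. by apply: cocycle3_norm; apply: Or33. Qed.

Let gsimp := (@invMg gT, @invgK gT, @mulgA gT, @mulgK gT, @mulgKV gT,
  @mulVg gT, @mulgV gT, @mul1g gT, @mulg1 gT, @invg1 gT).
Let cC := cocycle3E w.

Let transfer (a b L R : k) : L = R -> R != 0 -> a * R = b * L -> a = b.
Proof. by move=> -> R0 /(mulIf R0). Qed.

Let eqM (a b c d : k) : a = b -> c = d -> a * c = b * d.
Proof. by move=> -> ->. Qed.

Lemma theta_neq0 g x y : theta w g x y != 0.
Proof. by rewrite /theta !mulf_neq0 ?invr_neq0. Qed.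

Lemma gamma_neq0 g x y : gamma w g x y != 0.
Proof. by rewrite /gamma !mulf_neq0 ?invr_neq0. Qed.

Lemma theta1x g x : theta w g 1 x = 1.
Proof. by rewrite /theta !(w1xx, wx1x, wxx1) divr1 mulr1. Qed.

Lemma thetax1 g x : theta w g x 1 = 1.
Proof. by rewrite /theta !(w1xx, wx1x, wxx1) divr1 mulr1. Qed.

Lemma theta11 x y : theta w 1 x y = 1.
Proof. by rewrite /theta !gsimp !(w1xx, wx1x, wxx1) divr1 mulr1. Qed.

Lemma gamma1x x y : gamma w 1 x y = 1.
Proof. by rewrite /gamma !(w1xx, wx1x, wxx1) divr1 mulr1. Qed.

Lemma gammax1 g x : gamma w g x 1 = 1.
Proof. by rewrite /gamma !gsimp !(w1xx, wx1x, wxx1) divr1 mulr1. Qed.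

Lemma gamma11 g x : gamma w g 1 x = 1.
Proof. by rewrite /gamma !gsimp !(w1xx, wx1x, wxx1) divr1 mulr1. Qed.

Ltac wfield := field; rewrite ?w0 //.

Lemma thetaM g x y z :
  theta w g x y * theta w g (x * y)%g z
    = theta w g x (y * z)%g * theta w (x^-1 * g * x)%g y z.
Proof.
have E1 := cC g x y z.
have E2 := cC x (x^-1 * g * x)%g y z.
have E3 := cC x y ((x * y)^-1 * g * (x * y))%g z.
have E4 := cC x y z ((x * y * z)^-1 * g * (x * y * z))%g.
rewrite !gsimp in E1 E2 E3 E4; rewrite /theta !gsimp.
apply: (transfer (eqM (eqM E1 (esym E2)) (eqM E3 (esym E4)))).
  by rewrite !mulf_neq0.
by wfield.
Qed.

Lemma theta_gamma g h x y :
  gamma w x g h * gamma w y (x^-1 * g * x)%g (x^-1 * h * x)%g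
      * theta w g x y * theta w h x y
    = theta w (g * h)%g x y * gamma w (x * y)%g g h.
Proof.
have E1 := cC g h x y.
have E2 := cC g x (x^-1 * h * x)%g y.
have E3 := cC g x y ((x * y)^-1 * h * (x * y))%g.
have E4 := cC x (x^-1 * g * x)%g (x^-1 * h * x)%g y.
have E5 := cC x (x^-1 * g * x)%g y ((x * y)^-1 * h * (x * y))%g.
have E6 := cC x y ((x * y)^-1 * g * (x * y))%g ((x * y)^-1 * h * (x * y))%g.
rewrite !gsimp in E1 E2 E3 E4 E5 E6; rewrite /theta /gamma !gsimp.
apply: (transfer (eqM (eqM (eqM E1 (esym E2)) (eqM E3 E4))
                      (eqM (esym E5) E6))).
  by rewrite !mulf_neq0.
by wfield.
Qed.

Lemma gamma_assoc x g h l :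
  gamma w x g (h * l)%g * gamma w x h l * w g h l
    = gamma w x (g * h)%g l * gamma w x g h
        * w (x^-1 * g * x)%g (x^-1 * h * x)%g (x^-1 * l * x)%g.
Proof.
have E1 := cC g h l x.
have E2 := cC g h x (x^-1 * l * x)%g.
have E3 := cC g x (x^-1 * h * x)%g (x^-1 * l * x)%g.
have E4 := cC x (x^-1 * g * x)%g (x^-1 * h * x)%g (x^-1 * l * x)%g.
rewrite !gsimp in E1 E2 E3 E4; rewrite /gamma !gsimp.
apply: (transfer (eqM (eqM E1 (esym E2)) (eqM E3 (esym E4)))).
  by rewrite !mulf_neq0.
by wfield.
Qed.

Lemma w_inv g : w g g^-1%g g * w g^-1%g g g^-1%g = 1.
Proof.
have := cC g g^-1%g g g^-1%g.
by rewrite !gsimp !(w1xx, wx1x, wxx1) !mulr1.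
Qed.

End Scalars.

(** The underlying space [k[G]' (x) k[G]] of [D^w(G)]: [a] stands for
    [\sum_(g, x) a (g, x) *: (e(g) (x) x)]. *)
Definition twisted_double (gT : finGroupType) (k : fieldType)
    (w : cocycle3 gT k) : Type := {ffun gT * gT -> k^o}.

HB.instance Definition _ (gT : finGroupType) (k : fieldType)
  (w : cocycle3 gT k) := Vector.on (twisted_double w).

(** The basis vector [e(g) (x) x]. *)
Definition dbl (gT : finGroupType) (k : fieldType) (w : cocycle3 gT k)
    (g x : gT) : twisted_double w := [ffun p => (p == (g, x))%:R].

(** Linear extension of a map defined on the basis. *)
Definition dlift (gT : finGroupType) (k : fieldType) (w : cocycle3 gT k)
    (V : vectType k) (f : gT -> gT -> V) (a : twisted_double w) : V :=
  \sum_g \sum_x ((a : {ffun _}) (g, x) : k) *: f g x.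

Section DoubleAlgebra.
Variables (gT : finGroupType) (k : fieldType) (w : cocycle3 gT k).
Local Notation D := (twisted_double w).
Local Notation e := (dbl w).

Lemma dlift_is_linear (V : vectType k) (f : gT -> gT -> V) :
  linear (@dlift _ _ w V f).
Proof.
move=> c a b; rewrite /dlift scaler_sumr -big_split; apply: eq_bigr => g _ /=.
rewrite scaler_sumr -big_split; apply: eq_bigr => x _ /=.
by rewrite !ffunE scalerDl scalerA.
Qed.
HB.instance Definition _ (V : vectType k) (f : gT -> gT -> V) :=
  GRing.isLinear.Build k D V _ (@dlift _ _ w V f) (@dlift_is_linear V f).

Lemma dlift_dbl (V : vectType k) (f : gT -> gT -> V) g x :
  dlift f (e g x) = f g x.
Proof.
rewrite /dlift (bigD1 g) //= (bigD1 x) //= ffunE eqxx scale1r.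
rewrite big1 => [|y /negPf ne]; last by rewrite ffunE xpair_eqE ne andbF scale0r.
rewrite addr0 big1 ?addr0 // => h /negPf ne.
by rewrite big1 // => y _; rewrite ffunE xpair_eqE ne scale0r.
Qed.

Lemma dbl_sum (a : D) : a = dlift e a.
Proof.
apply/ffunP=> -[g x]; rewrite /dlift sum_ffunE (bigD1 g) //= sum_ffunE.
rewrite (bigD1 x) //= !ffunE eqxx [_ *: _]mulr1.
rewrite big1 => [|y /negPf ne]; last first.
  by rewrite !ffunE xpair_eqE [x == _]eq_sym ne andbF [_ *: _]mulr0.
rewrite addr0 big1 ?addr0 // => h /negPf ne; rewrite sum_ffunE.
by rewrite big1 // => y _; rewrite !ffunE xpair_eqE [g == _]eq_sym ne [_ *: _]mulr0.
Qed.

Lemma dbl_ind (P : D -> Prop) :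
  (forall c a b, P a -> P b -> P (c *: a + b)) -> (forall g x, P (e g x)) ->
  forall a, P a.
Proof.
move=> PL Pe a.
have P0 : P 0 by rewrite -(subrr (e 1%g 1%g)) addrC -scaleN1r; apply: PL.
rewrite (dbl_sum a) /dlift; apply: big_ind => // [x y Px Py|g _].
  by rewrite -[x]scale1r; apply: PL.
apply: big_ind => // [x y Px Py|x _].
  by rewrite -[x]scale1r; apply: PL.
by rewrite -[_ *: _]addr0; apply: PL.
Qed.

Definition dmul (a b : D) : D :=
  dlift (fun g x =>
    dlift (fun h y => (theta w g x y * (g == x * h * x^-1)%g%:R) *: e g (x * y)%g)
      b) a.

Definition dunit : D := \sum_g e g 1%g.

Lemma dmul_linl b : linear (dmul^~ b).
Proof. by move=> c u v; rewrite /dmul linearP. Qed.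

Lemma dmul_linr a : linear (dmul a).
Proof.
move=> c u v; rewrite /dmul /dlift scaler_sumr -big_split.
apply: eq_bigr => g _ /=; rewrite scaler_sumr -big_split.
apply: eq_bigr => x _ /=; rewrite -![\sum_h \sum_y _]/(dlift _ _).
by rewrite linearP scalerDr !scalerA mulrC.
Qed.

Let dmulDl : left_distributive dmul +%R.
Proof. by move=> s t u; have:= dmul_linl u 1 s t; rewrite /= !scale1r. Qed.
Let dmulDr : right_distributive dmul +%R.
Proof. by move=> s t u; have:= dmul_linr s 1 t u; rewrite /= !scale1r. Qed.
Let dmul0l t : dmul 0 t = 0.
Proof. by rewrite /dmul linear0. Qed.
Let dmul0r t : dmul t 0 = 0.
Proof. by apply: (addrI (dmul t 0)); rewrite -dmulDr !addr0. Qed.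
Let dmulZl c s t : c *: dmul s t = dmul (c *: s) t.
Proof. by have:= dmul_linl t c s 0; rewrite !addr0 /= dmul0l addr0. Qed.
Let dmulZr c s t : c *: dmul s t = dmul s (c *: t).
Proof. by have:= dmul_linr s c t 0; rewrite !addr0 /= dmul0r addr0. Qed.

Let dmul_dbl g x h y :
  dmul (e g x) (e h y)
    = (theta w g x y * (g == x * h * x^-1)%g%:R) *: e g (x * y)%g.
Proof. by rewrite /dmul !dlift_dbl. Qed.

Let dmulA : associative dmul.
Proof.
move=> a b c; elim/dbl_ind: a => [r a a' IH IH'|g x].
  by rewrite !(dmulDl, =^~ dmulZl) IH IH'.
elim/dbl_ind: b => [r b b' IH IH'|h y].
  by rewrite !(dmulDl, dmulDr, =^~ dmulZr, =^~ dmulZl) IH IH'.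
elim/dbl_ind: c => [r c c' IH IH'|l z].
  by rewrite !(dmulDl, dmulDr, =^~ dmulZr, =^~ dmulZl) IH IH'.
rewrite !dmul_dbl -dmulZl -dmulZr !dmul_dbl !scalerA mulgA; congr (_ *: _).
case: (g =P _) => [->|_]; last by rewrite !mulr0 mul0r.
have /= := thetaM w (x * h * x^-1)%g x y z.
rewrite !mulgA mulVg mul1g mulgKV => Eq; rewrite !mulr1.
have -> : (x * h * x^-1 == x * y * l * (x * y)^-1)%g = (h == y * l * y^-1)%g.
  by rewrite invMg !mulgA (inj_eq (mulIg _)) -!mulgA (inj_eq (mulgI _)).
by ring: Eq.
Qed.

Let dmul1l : left_id dunit dmul.
Proof.
elim/dbl_ind => [r b b' IH IH'|h y]; first by rewrite dmulDr -dmulZr IH IH'.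
rewrite /dmul /dunit linear_sum (bigD1 h) //= !dlift_dbl.
rewrite big1 => [|g ne]; rewrite ?dlift_dbl !mul1g invg1 mulg1.
  by rewrite eqxx theta1x mulr1 scale1r addr0.
by rewrite (negPf ne) mulr0 scale0r.
Qed.

Let dmul1r : right_id dunit dmul.
Proof.
elim/dbl_ind => [r b b' IH IH'|h y]; first by rewrite dmulDl -dmulZl IH IH'.
rewrite /dmul /dunit dlift_dbl linear_sum (bigD1 (y^-1 * h * y)%g) //= !dlift_dbl.
rewrite big1 => [|g ne]; rewrite ?dlift_dbl !mulg1 thetax1 mul1r.
  by rewrite !mulgA mulgV mul1g mulgK eqxx scale1r addr0.
rewrite (_ : (_ == _) = false) ?scale0r //; apply: contraNF ne => /eqP->.
by rewrite !mulgA mulVg mul1g mulgKV.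
Qed.

Let dunit_neq0 : dunit != 0.
Proof.
apply/eqP=> /ffunP/(_ (1, 1)%g); rewrite sum_ffunE (bigD1 1%g) //= !ffunE eqxx.
rewrite big1 => [/eqP|g /negPf ne]; first by rewrite addr0 oner_eq0.
by rewrite ffunE xpair_eqE eq_sym ne.
Qed.

HB.instance Definition _ := GRing.Zmodule_isNzRing.Build D
  dmulA dmul1l dmul1r dmulDl dmulDr dunit_neq0.
HB.instance Definition _ := GRing.Lmodule_isLalgebra.Build k D dmulZl.
HB.instance Definition _ := GRing.Lalgebra_isAlgebra.Build k D dmulZr.
HB.instance Definition _ := Algebra_isFalgebra.Build k D.

Lemma dblM g x h y :
  e g x * e h y = (theta w g x y * (g == x * h * x^-1)%g%:R) *: e g (x * y)%g.
Proof. exact: dmul_dbl. Qed.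

Lemma dbl1 : 1 = \sum_g e g 1%g.
Proof. by []. Qed.

End DoubleAlgebra.

Section DoubleStructure.
Variables (gT : finGroupType) (k : fieldType) (w : cocycle3 gT k).
Local Notation D := (twisted_double w).
Local Notation e := (dbl w).

Definition dcomult : D -> D \otimes D :=
  dlift (fun g x => \sum_(p : gT * gT | (p.1 * p.2)%g == g)
    gamma w x p.1 p.2 *: (e p.1 x \ot e p.2 x)).

Definition dcounit : D -> k^o := dlift (fun g x => ((g == 1%g)%:R : k^o)).

Definition dassociator : D \otimes D \otimes D :=
  \sum_g \sum_h \sum_l (w g h l)^-1 *: (e g 1%g \ot e h 1%g \ot e l 1%g).

Definition dbeta : D := \sum_g w g g^-1%g g *: e g 1%g.

Definition santi g x : k :=
  (theta w g^-1%g x x^-1%g)^-1 * (gamma w x g g^-1%g)^-1.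

Definition dantipode : 'End(D) := linfun (dlift (fun g x =>
  santi g x *: e (x^-1 * g^-1 * x)%g x^-1%g)).

Lemma sum_delta (V : zmodType) (F : gT -> V) a :
  (forall b, b != a -> F b = 0) -> \sum_b F b = F a.
Proof. by move=> h; rewrite (bigD1 a) //= big1 ?addr0. Qed.

Lemma sum_mul (V : zmodType) (F : gT -> gT -> V) g :
  \sum_(p : gT * gT | (p.1 * p.2)%g == g) F p.1 p.2 = \sum_a F a (a^-1 * g)%g.
Proof.
rewrite -(pair_big_dep predT (fun a b => (a * b)%g == g) F) /=.
apply: eq_bigr => a _; rewrite (big_pred1 (a^-1 * g)%g) // => b.
by rewrite -(inj_eq (mulgI a^-1%g)) mulKg.
Qed.

Lemma dcomult_dbl g x : dcomult (e g x) =
  \sum_a gamma w x a (a^-1 * g)%g *: (e a x \ot e (a^-1 * g)%g x).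
Proof.
rewrite /dcomult dlift_dbl.
exact: (sum_mul (fun a b => gamma w x a b *: (e a x \ot e b x))).
Qed.

HB.instance Definition _ := GRing.isLinear.Build k D (D \otimes D) _ dcomult
  (@dlift_is_linear gT k w (D \otimes D) _).
HB.instance Definition _ := GRing.isLinear.Build k D k^o _ dcounit
  (@dlift_is_linear gT k w k^o _).

Lemma dcounit_dbl g x : dcounit (e g x) = (g == 1%g)%:R.
Proof. exact: dlift_dbl. Qed.

Lemma dcounit_mult : monoid_morphism dcounit.
Proof.
split=> [|a b].
  rewrite dbl1 linear_sum (sum_delta (a := 1%g)) => [|b /negPf ne] /=;
    by rewrite dcounit_dbl ?eqxx ?ne.
elim/dbl_ind: a => [c a a' IH IH'|g x].
  by rewrite mulrDl -scalerAl !linearP /= IH IH' mulrDl scalerAl.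
elim/dbl_ind: b => [c b b' IH IH'|h y].
  by rewrite mulrDr -scalerAr !linearP /= IH IH' mulrDr scalerAr.
rewrite dblM linearZ /= !dcounit_dbl -[LHS]/(_ * _ : k).
case: (eqVneq g 1%g) => [->|_]; last by rewrite mul0r mulr0.
rewrite theta11 mul1r mulr1 mul1r; congr (_%:R).
by rewrite -(inj_eq (mulgI x^-1%g)) -(inj_eq (mulIg x)) mulg1 mulVg !mulgA mulVg
  mul1g mulgKV eq_sym.
Qed.
HB.instance Definition _ :=
  GRing.isMonoidMorphism.Build D k^o dcounit dcounit_mult.

Lemma dcomult_mult : monoid_morphism dcomult.
Proof.
split=> [|a b].
  rewrite -tens1 dbl1 linear_sum tens_suml /=.
  under eq_bigr do rewrite dcomult_dbl; rewrite exchange_big.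
  apply: eq_bigr => a _; rewrite tens_sumr (reindex_inj (mulgI a)) /=.
  by apply: eq_bigr => b _; rewrite mulKg gamma1x scale1r.
elim/dbl_ind: a => [c a a' IH IH'|g x].
  by rewrite mulrDl -scalerAl !linearP /= IH IH' mulrDl scalerAl.
elim/dbl_ind: b => [c b b' IH IH'|h y].
  by rewrite mulrDr -scalerAr !linearP /= IH IH' mulrDr scalerAr.
rewrite dblM linearZ /= !dcomult_dbl mulr_suml scaler_sumr.
apply: eq_bigr => a _; rewrite mulr_sumr (sum_delta (a := (x^-1 * a * x)%g)).
  rewrite -scalerAl -scalerAr tensM !dblM !scalerA.
  have -> : (x * (x^-1 * a * x) * x^-1)%g = a by rewrite !mulgA mulgV mul1g mulgK.
  have -> : (a^-1 * g == x * ((x^-1 * a * x)^-1 * h) * x^-1)%g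
            = (g == x * h * x^-1)%g.
    rewrite !invMg invgK !mulgA mulgV mul1g -[in RHS](inj_eq (mulgI a^-1%g)).
    by rewrite !mulgA.
  rewrite tensZl tensZr !scalerA eqxx !mulr1.
  case: (eqVneq g (x * h * x^-1)%g) => [gE|_]; last by rewrite !(mulr0, mul0r) !scale0r.
  rewrite !mulr1; congr (_ *: _).
  have := theta_gamma w a (a^-1 * g)%g x y.
  rewrite mulKVg => <-.
  have -> // : ((x^-1 * a * x)^-1 * h = x^-1 * (a^-1 * g) * x)%g.
    by rewrite gE !invMg invgK !mulgA mulgKV.
  by ring.
move=> b ne; rewrite -scalerAl -scalerAr tensM !dblM.
rewrite (_ : (a == _) = false) ?mulr0 ?scale0r ?tens0l ?scaler0 //.
apply: contraNF ne => /eqP->.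
by rewrite !mulgA mulVg mul1g mulgKV.
Qed.
HB.instance Definition _ :=
  GRing.isMonoidMorphism.Build D (D \otimes D) dcomult dcomult_mult.

(** Elements of the span of the [e(a) (x) 1 (x) ... (x) e(c) (x) 1]. *)
Definition diag3 (f : gT -> gT -> gT -> k) : D \otimes D \otimes D :=
  \sum_a \sum_b \sum_c f a b c *: (e a 1%g \ot e b 1%g \ot e c 1%g).

Definition diag4 (f : gT -> gT -> gT -> gT -> k) : D \otimes D \otimes D \otimes D :=
  \sum_a \sum_b \sum_c \sum_d
    f a b c d *: (e a 1%g \ot e b 1%g \ot e c 1%g \ot e d 1%g).

Lemma dbl1l a g x : e a 1%g * e g x = (a == g)%:R *: e g x.
Proof.
rewrite dblM theta1x !mul1g invg1 mulg1 mul1r.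
by case: (eqVneq a g) => [->|_]; rewrite ?scale0r.
Qed.

Lemma dbl1r a g x : e g x * e a 1%g = (a == x^-1 * g * x)%g%:R *: e g x.
Proof.
rewrite dblM thetax1 mulg1 mul1r; congr ((nat_of_bool _)%:R *: _).
by rewrite -(inj_eq (mulgI x^-1%g)) -(inj_eq (mulIg x)) !mulgA mulVg mul1g mulgKV
  eq_sym.
Qed.

Lemma diag3l f a b c x y z :
  diag3 f * (e a x \ot e b y \ot e c z) = f a b c *: (e a x \ot e b y \ot e c z).
Proof.
rewrite /diag3 mulr_suml (sum_delta (a := a)) => [|a' /negPf ne]; last first.
  rewrite mulr_suml big1 // => ? _; rewrite mulr_suml big1 // => ? _.
  by rewrite -scalerAl !tensM dbl1l ne scale0r !tens0l scaler0.
rewrite mulr_suml (sum_delta (a := b)) => [|b' /negPf ne]; last first.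
  rewrite mulr_suml big1 // => ? _.
  by rewrite -scalerAl !tensM !dbl1l ne scale0r tens0r tens0l scaler0.
rewrite mulr_suml (sum_delta (a := c)) => [|c' /negPf ne]; last first.
  by rewrite -scalerAl !tensM !dbl1l ne scale0r tens0r scaler0.
by rewrite -scalerAl !tensM !dbl1l !eqxx !scale1r.
Qed.

Lemma diag3r f a b c x y z :
  (e a x \ot e b y \ot e c z) * diag3 f
    = f (x^-1 * a * x)%g (y^-1 * b * y)%g (z^-1 * c * z)%g
        *: (e a x \ot e b y \ot e c z).
Proof.
rewrite /diag3 mulr_sumr (sum_delta (a := (x^-1 * a * x)%g)) => [|a' /negPf ne];
    last first.
  rewrite mulr_sumr big1 // => ? _; rewrite mulr_sumr big1 // => ? _.
  by rewrite -scalerAr !tensM dbl1r ne scale0r !tens0l scaler0.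
rewrite mulr_sumr (sum_delta (a := (y^-1 * b * y)%g)) => [|b' /negPf ne]; last first.
  rewrite mulr_sumr big1 // => ? _.
  by rewrite -scalerAr !tensM !dbl1r ne scale0r tens0r tens0l scaler0.
rewrite mulr_sumr (sum_delta (a := (z^-1 * c * z)%g)) => [|c' /negPf ne]; last first.
  by rewrite -scalerAr !tensM !dbl1r ne scale0r tens0r scaler0.
by rewrite -scalerAr !tensM !dbl1r !eqxx !scale1r.
Qed.

Lemma diag3M f g : diag3 f * diag3 g = diag3 (fun a b c => f a b c * g a b c).
Proof.
rewrite {2}/diag3 mulr_sumr; apply: eq_bigr => a _.
rewrite mulr_sumr; apply: eq_bigr => b _; rewrite mulr_sumr.
by apply: eq_bigr => c _; rewrite -scalerAr diag3l scalerA mulrC.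
Qed.

Lemma diag3_1 : diag3 (fun _ _ _ => 1) = 1.
Proof.
rewrite -tens1 -[X in X \ot _]tens1 dbl1 !tens_suml; apply: eq_bigr => a _.
rewrite (tens_sumr predT (e a 1%g)) tens_suml; apply: eq_bigr => b _.
rewrite tens_sumr.
by apply: eq_bigr => c _; rewrite scale1r.
Qed.

Lemma eq_diag3 f g : (forall a b c, f a b c = g a b c) -> diag3 f = diag3 g.
Proof.
by move=> fg; do 3 (apply: eq_bigr => ? _); rewrite fg.
Qed.

Lemma diag4M f g :
  diag4 f * diag4 g = diag4 (fun a b c d => f a b c d * g a b c d).
Proof.
rewrite {2}/diag4 mulr_sumr; apply: eq_bigr => a _.
rewrite mulr_sumr; apply: eq_bigr => b _; rewrite mulr_sumr.
apply: eq_bigr => c _; rewrite mulr_sumr; apply: eq_bigr => d _.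
rewrite -scalerAr /diag4 mulr_suml (sum_delta (a := a)) => [|a' /negPf ne]; last first.
  rewrite mulr_suml big1 // => ? _; rewrite mulr_suml big1 // => ? _.
  rewrite mulr_suml big1 // => ? _.
  by rewrite -scalerAl !tensM dbl1l ne scale0r !tens0l scaler0.
rewrite mulr_suml (sum_delta (a := b)) => [|b' /negPf ne]; last first.
  rewrite mulr_suml big1 // => ? _; rewrite mulr_suml big1 // => ? _.
  by rewrite -scalerAl !tensM !dbl1l ne scale0r tens0r !tens0l scaler0.
rewrite mulr_suml (sum_delta (a := c)) => [|c' /negPf ne]; last first.
  rewrite mulr_suml big1 // => ? _.
  by rewrite -scalerAl !tensM !dbl1l ne scale0r tens0r tens0l scaler0.
rewrite mulr_suml (sum_delta (a := d)) => [|d' /negPf ne]; last first.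
  by rewrite -scalerAl !tensM !dbl1l ne scale0r tens0r scaler0.
by rewrite -scalerAl !tensM !dbl1l !eqxx !scale1r scalerA mulrC.
Qed.

Lemma eq_diag4 f g : (forall a b c d, f a b c d = g a b c d) -> diag4 f = diag4 g.
Proof.
by move=> fg; do 4 (apply: eq_bigr => ? _); rewrite fg.
Qed.

Let w0 x y z : w x y z != 0. Proof. exact: cocycle3_neq0. Qed.

Lemma dassociatorE : dassociator = diag3 (fun a b c => (w a b c)^-1).
Proof. by []. Qed.

Lemma dassociatorMV : dassociator * diag3 w = 1.
Proof.
by rewrite diag3M -diag3_1; apply: eq_diag3 => a b c; rewrite mulVf.
Qed.

Lemma dassociatorVM : diag3 w * dassociator = 1.
Proof.
by rewrite diag3M -diag3_1; apply: eq_diag3 => a b c; rewrite mulfV.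
Qed.

Lemma dassociator_unit : dassociator \is a GRing.unit.
Proof. by apply/unitrP; exists (diag3 w); rewrite dassociatorMV dassociatorVM. Qed.

Lemma dassociatorV : dassociator^-1 = diag3 w.
Proof.
by rewrite -[LHS]mulr1 -dassociatorMV mulKr // dassociator_unit.
Qed.

Lemma dcounitl h : tlift (fun a b => (dcounit a : k) *: b) (dcomult h) = h.
Proof.
elim/dbl_ind: h => [c a b IH IH'|g x]; first by rewrite !linearP /= IH IH'.
have bi : bilin (fun a b : D => (dcounit a : k) *: b).
  split=> [b c a a'|a c b b']; first by rewrite linearP scalerDl scalerA.
  by rewrite scalerDr !scalerA mulrC.
rewrite dcomult_dbl linear_sum (sum_delta (a := 1%g)) => [|a /negPf ne].
  rewrite linearZ /= tlift_tens // dcounit_dbl eqxx invg1 mul1g scale1r.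
  by rewrite gamma11 scale1r.
by rewrite linearZ /= tlift_tens // dcounit_dbl ne scale0r scaler0.
Qed.

Lemma dcounitr h : tlift (fun a b => (dcounit b : k) *: a) (dcomult h) = h.
Proof.
elim/dbl_ind: h => [c a b IH IH'|g x]; first by rewrite !linearP /= IH IH'.
have bi : bilin (fun a b : D => (dcounit b : k) *: a).
  split=> [b c a a'|a c b b']; last by rewrite linearP scalerDl scalerA.
  by rewrite scalerDr !scalerA mulrC.
rewrite dcomult_dbl linear_sum (sum_delta (a := g)) => [|a ne].
  rewrite linearZ /= tlift_tens // dcounit_dbl mulVg eqxx scale1r.
  by rewrite gammax1 scale1r.
rewrite linearZ /= tlift_tens // dcounit_dbl (_ : (_ == _) = false).
  by rewrite scale0r scaler0.
by apply: contraNF ne; rewrite -(inj_eq (mulgI a)) mulKVg mulg1 eq_sym.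
Qed.

Lemma dcomult_lin : linear dcomult. Proof. exact: linearP. Qed.
Lemma idfun_lin : linear (@idfun D). Proof. exact: linearP. Qed.

Lemma dquasi_coassoc h :
  tassoc (tmap idfun dcomult (dcomult h)) * dassociator
    = dassociator * tmap dcomult idfun (dcomult h).
Proof.
elim/dbl_ind: h => [c a b IH IH'|g x].
  by rewrite !linearP mulrDl mulrDr -!scalerAl -!scalerAr IH IH'.
rewrite !dcomult_dbl [tmap idfun _ _]linear_sum [tmap _ idfun _]linear_sum.
rewrite [tassoc _]linear_sum mulr_suml mulr_sumr /=.
under eq_bigr => a _.
  rewrite !linearZ /= tmap_tens; [|exact: idfun_lin|exact: dcomult_lin].
  rewrite /= dcomult_dbl tens_sumr [tassoc _]linear_sum -scalerAl mulr_suml scaler_sumr.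
  under eq_bigr => b _.
    rewrite tensZr linearZ /= tassoc_tens -scalerAl dassociatorE diag3r !scalerA.
  over.
over.
under [in RHS]eq_bigr => c _.
  rewrite !linearZ /= tmap_tens; [|exact: dcomult_lin|exact: idfun_lin].
  rewrite /= dcomult_dbl tens_suml -scalerAr mulr_sumr scaler_sumr.
  under eq_bigr => b _.
    rewrite tensZl -scalerAr dassociatorE diag3l !scalerA.
  over.
over.
rewrite /= [RHS]exchange_big; apply: eq_bigr => a _.
rewrite [RHS](reindex_inj (mulgI a)); apply: eq_bigr => b _ /=.
rewrite !mulKg invMg !mulgA; congr (_ *: _).
have Eq := gamma_assoc w x a b (b^-1 * a^-1 * g)%g; rewrite !mulgA mulgV mul1g in Eq.
apply: (mulIf (w0 a b (b^-1 * a^-1 * g)%g)).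
apply: (mulIf (w0 (x^-1 * a * x)%g (x^-1 * b * x)%g (x^-1 * (b^-1 * a^-1 * g) * x)%g)).
rewrite !mulgA.
by field: Eq; rewrite !w0.
Qed.

Let gsimp := (@invMg gT, @invgK gT, @mulgA gT, @mulgK gT, @mulgKV gT,
  @mulVg gT, @mulgV gT, @mul1g gT, @mulg1 gT, @invg1 gT).

Lemma tassoc_lin (V W U : vectType k) : linear (@tassoc k V W U).
Proof. exact: linearP. Qed.

Lemma dassociator_counit :
  tlift3 (fun a b c => (dcounit b : k) *: (a \ot c)) dassociator = 1.
Proof.
rewrite -tens1 dbl1 tens_suml [LHS]linear_sum; apply: eq_bigr => a _ /=.
rewrite tens_sumr [LHS]linear_sum (sum_delta (a := 1%g)) => [|b ne].
  rewrite [LHS]linear_sum; apply: eq_bigr => c _ /=.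
  rewrite [LHS]linearZ /= tlift3_tens; last 3 first.
  - by move=> *; move=> ? ? ?; rewrite tens_linl scalerDr !scalerA mulrC.
  - by move=> *; move=> ? ? ?; rewrite linearP scalerDl scalerA.
  - by move=> *; move=> ? ? ?; rewrite tens_linr scalerDr !scalerA mulrC.
  by rewrite dcounit_dbl eqxx scale1r cocycle3_norm ?invr1 ?scale1r //; apply: Or32.
rewrite [LHS]linear_sum big1 // => c _.
rewrite [LHS]linearZ /= tlift3_tens; last 3 first.
- by move=> *; move=> ? ? ?; rewrite tens_linl scalerDr !scalerA mulrC.
- by move=> *; move=> ? ? ?; rewrite linearP scalerDl scalerA.
- by move=> *; move=> ? ? ?; rewrite tens_linr scalerDr !scalerA mulrC.
by rewrite dcounit_dbl (negPf ne) scale0r scaler0.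
Qed.

Lemma dcomult_dbl1 g :
  dcomult (e g 1%g) = \sum_a e a 1%g \ot e (a^-1 * g)%g 1%g.
Proof.
by rewrite dcomult_dbl; apply: eq_bigr => a _; rewrite gamma1x scale1r.
Qed.

Lemma tmap3 f (F : {linear D \otimes D -> D \otimes D \otimes D}) :
  tmap F (@idfun D) (diag3 f)
    = \sum_a \sum_b \sum_c
        f a b c *: (F (e a 1%g \ot e b 1%g) \ot e c 1%g).
Proof.
rewrite [LHS]linear_sum; apply: eq_bigr => a _ /=.
rewrite [LHS]linear_sum; apply: eq_bigr => b _ /=.
rewrite [LHS]linear_sum; apply: eq_bigr => c _ /=.
by rewrite [LHS]linearZ /= tmap_tens //; exact: linearP.
Qed.

Lemma dpentagon :
    tassoc (tmap idfun dcomult dassociator)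
        * tmap (tmap dcomult idfun) idfun dassociator
      = tmap (@tassoc k D D D) idfun (tassoc ((1 : D) \ot dassociator))
        * tmap (fun t => tassoc (tmap idfun dcomult t)) idfun dassociator
        * (dassociator \ot (1 : D)).
Proof.
have -> : tassoc (tmap idfun dcomult dassociator)
    = diag4 (fun a b c d => (w a b (c * d)%g)^-1).
  rewrite [tmap _ _ _]linear_sum [LHS]linear_sum; apply: eq_bigr => a _ /=.
  rewrite [tmap _ _ _]linear_sum [LHS]linear_sum; apply: eq_bigr => b _ /=.
  rewrite [tmap _ _ _]linear_sum [LHS]linear_sum /=.
  under eq_bigr => c _.
    rewrite [tmap _ _ _]linearZ /= [tassoc _]linearZ /= tmap_tens;
      [|exact: linearP|exact: dcomult_lin].
    rewrite /= dcomult_dbl1 tens_sumr [tassoc _]linear_sum scaler_sumr.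
    under eq_bigr => d _ do rewrite /= tassoc_tens.
  over.
  rewrite exchange_big; apply: eq_bigr => c _ /=.
  by rewrite (reindex_inj (mulgI c)); apply: eq_bigr => d _; rewrite mulKg.
have -> : tmap (tmap dcomult idfun) idfun dassociator
    = diag4 (fun a b c d => (w (a * b)%g c d)^-1).
  rewrite (tmap3 _ (tmap dcomult idfun)).
  under eq_bigr => a _.
    under eq_bigr => b _.
      under eq_bigr => c _.
        rewrite /= tmap_tens; [|exact: dcomult_lin|exact: idfun_lin].
        rewrite /= dcomult_dbl1 !tens_suml scaler_sumr.
      over.
      rewrite exchange_big.
    over.
    rewrite exchange_big.
  over.
  rewrite exchange_big; apply: eq_bigr => a _ /=.
  rewrite (reindex_inj (mulgI a)); apply: eq_bigr => b _ /=.
  by do 2 (apply: eq_bigr => ? _); rewrite mulKg.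
have -> : tmap (@tassoc k D D D) idfun (tassoc ((1 : D) \ot dassociator))
    = diag4 (fun a b c d => (w b c d)^-1).
  rewrite dbl1 tens_suml [tassoc _]linear_sum [LHS]linear_sum.
  apply: eq_bigr => a _ /=.
  rewrite tens_sumr [tassoc _]linear_sum [LHS]linear_sum.
  apply: eq_bigr => b _ /=.
  rewrite tens_sumr [tassoc _]linear_sum [LHS]linear_sum.
  apply: eq_bigr => c _ /=.
  rewrite tens_sumr [tassoc _]linear_sum [LHS]linear_sum.
  apply: eq_bigr => d _ /=.
  rewrite tensZr [tassoc _]linearZ [LHS]linearZ /= tassoc_tens tmap_tens;
    [|exact: tassoc_lin|exact: idfun_lin].
  by rewrite tassoc_tens.
have -> : tmap (fun t => tassoc (tmap idfun dcomult t)) idfun dassociator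
    = diag4 (fun a b c d => (w a (b * c)%g d)^-1).
  have lF : linear (fun t : D \otimes D => tassoc (tmap (@idfun D) dcomult t)).
    by move=> ? ? ?; rewrite !linearP.
  pose F := GRing.isLinear.Build k _ _ _ _ lF.
  pose FF : {linear D \otimes D -> D \otimes D \otimes D} :=
    HB.pack (fun t : D \otimes D => tassoc (tmap (@idfun D) dcomult t)) F.
  rewrite (tmap3 _ FF); apply: eq_bigr => a _ /=.
  under eq_bigr => b _.
    under eq_bigr => c _.
      rewrite /= tmap_tens; [|exact: idfun_lin|exact: dcomult_lin].
      rewrite /= dcomult_dbl1 tens_sumr [tassoc _]linear_sum tens_suml scaler_sumr.
      under eq_bigr => d _ do rewrite /= tassoc_tens.
    over.
    rewrite exchange_big.
  over.
  rewrite exchange_big; apply: eq_bigr => b _ /=.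
  rewrite (reindex_inj (mulgI b)); apply: eq_bigr => c _ /=.
  by apply: eq_bigr => ? _; rewrite mulKg.
have -> : dassociator \ot (1 : D) = diag4 (fun a b c d => (w a b c)^-1).
  rewrite dbl1 tens_suml; apply: eq_bigr => a _ /=.
  rewrite tens_suml; apply: eq_bigr => b _ /=.
  rewrite tens_suml; apply: eq_bigr => c _ /=.
  by rewrite tens_sumr; apply: eq_bigr => d _; rewrite tensZl.
rewrite !diag4M; apply: eq_diag4 => a b c d; rewrite -!invfM; congr (_^-1).
by have := cocycle3E w a b c d; move=> Eq; ring: Eq.
Qed.

Lemma santi_neq0 g x : santi g x != 0.
Proof. by rewrite /santi mulf_neq0 ?invr_neq0 ?theta_neq0 ?gamma_neq0. Qed.

Lemma dantipode_dbl g x :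
  dantipode (e g x) = santi g x *: e (x^-1 * g^-1 * x)%g x^-1%g.
Proof. by rewrite /dantipode lfunE /= dlift_dbl. Qed.

Lemma santi1 g : santi g 1 = 1.
Proof. by rewrite /santi theta1x gamma1x !invr1 mulr1. Qed.

Lemma dantipode_dbl1 g : dantipode (e g 1%g) = e g^-1%g 1%g.
Proof. by rewrite dantipode_dbl santi1 scale1r invg1 mul1g mulg1. Qed.

Lemma dantipode1 : dantipode 1 = 1.
Proof.
rewrite dbl1 linear_sum (reindex_inj invg_inj); apply: eq_bigr => a _ /=.
by rewrite dantipode_dbl1 invgK.
Qed.

Lemma dantipodeM a b : dantipode (a * b) = dantipode b * dantipode a.
Proof.
elim/dbl_ind: a => [c a a' IH IH'|g x].
  by rewrite mulrDl -scalerAl !linearP /= IH IH' mulrDr scalerAr.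
elim/dbl_ind: b => [c b b' IH IH'|h y].
  by rewrite mulrDr -scalerAr !linearP /= IH IH' mulrDl scalerAl.
rewrite dblM linearZ /= !dantipode_dbl -scalerAl -scalerAr dblM !scalerA.
rewrite -(invMg x y).
have -> : (y^-1 * h^-1 * y == y^-1 * (x^-1 * g^-1 * x) * y^-1^-1)%g
          = (g == x * h * x^-1)%g.
  rewrite invgK -[in RHS](inj_eq invg_inj) !invMg invgK.
  rewrite -!mulgA (inj_eq (mulgI _)) !mulgA (inj_eq (mulIg _)).
  by rewrite -[in RHS](inj_eq (mulgI x^-1%g)) -[in RHS](inj_eq (mulIg x))
    !mulgA mulVg mul1g mulgKV eq_sym.
case: (g =P _) => [->|_]; last by rewrite !(mulr0, mul0r) !scale0r.
have -> : ((x * y)^-1 * (x * h * x^-1)^-1 * (x * y) = y^-1 * h^-1 * y)%g.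
  by rewrite !invMg invgK !mulgA mulgKV mulgKV.
rewrite !mulr1; congr (_ *: _); rewrite /santi.
have E1 := theta_gamma w (x * h * x^-1)%g (x * h * x^-1)^-1%g x y.
have E2 := thetaM w (x * h * x^-1)^-1%g x y (x * y)^-1%g.
have E3 := thetaM w (x^-1 * (x * h * x^-1)^-1 * x)%g y y^-1%g x^-1%g.
rewrite !gsimp !(theta11, theta1x, mul1r, mulr1) in E1 E2 E3; rewrite !gsimp.
have t0 := theta_neq0 w; have g0 := gamma_neq0 w.
rewrite -E1.
by field: E2 E3; rewrite ?t0 ?g0.
Qed.

Lemma dantipode_bij : bijective dantipode.
Proof.
pose T : 'End(D) := linfun (dlift (fun g x =>
  (santi (x^-1 * g^-1 * x)%g x^-1%g)^-1 *: e (x^-1 * g^-1 * x)%g x^-1%g)).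
have TE g x : T (e g x) = (santi (x^-1 * g^-1 * x)%g x^-1%g)^-1
    *: e (x^-1 * g^-1 * x)%g x^-1%g by rewrite lfunE /= dlift_dbl.
exists T => a; elim/dbl_ind: a => [c a b IH IH'|g x];
  rewrite ?linearP /= ?IH ?IH' //.
  rewrite dantipode_dbl linearZ /= TE scalerA !gsimp.
  by rewrite mulfV ?scale1r // santi_neq0.
rewrite TE linearZ /= dantipode_dbl scalerA !gsimp.
by rewrite mulVf ?scale1r // santi_neq0.
Qed.

Lemma santil x a :
  gamma w x a a^-1%g * (santi a x * theta w (x^-1 * a^-1 * x)%g x^-1%g x) = 1.
Proof.
have := thetaM w a^-1%g x x^-1%g x.
rewrite !gsimp theta1x thetax1 mulr1 mul1r /santi => ->.
by field; rewrite theta_neq0 gamma_neq0.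
Qed.

Lemma conjg_eq1 (x a g : gT) :
  (x^-1 * a^-1 * x == x^-1 * (a^-1 * g) * x)%g = (g == 1%g).
Proof.
rewrite !mulgA (inj_eq (mulIg x)) -!mulgA (inj_eq (mulgI _)).
by rewrite -{1}[a^-1%g]mulg1 (inj_eq (mulgI _)) eq_sym.
Qed.

Lemma conjVg_inj (x : gT) : injective (fun a : gT => x^-1 * a^-1 * x)%g.
Proof. by move=> a b /mulIg/mulgI/invg_inj. Qed.

Lemma dantipodel h :
  tlift (fun a b => dantipode a * 1 * b) (dcomult h) = (dcounit h : k) *: 1.
Proof.
elim/dbl_ind: h => [c a b IH IH'|g x].
  by rewrite !linearP /= IH IH' scalerDl scalerA.
have bi : bilin (fun a b : D => dantipode a * 1 * b).
  split=> [b c a a'|a c b b']; rewrite !mulr1.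
    by rewrite linearP mulrDl scalerAl.
  by rewrite mulrDr scalerAr.
rewrite dcomult_dbl [LHS]linear_sum dcounit_dbl /= dbl1.
transitivity (\sum_a (g == 1%g)%:R *: e (x^-1 * a^-1 * x)%g 1%g); last first.
  by rewrite [in RHS](reindex_inj (@conjVg_inj x)) scaler_sumr.
apply: eq_bigr => a _.
rewrite [LHS]linearZ /= tlift_tens // dantipode_dbl mulr1 -scalerAl dblM.
rewrite invgK conjg_eq1 mulVg !scalerA.
case: (g =P _) => [->|_]; last by rewrite !mulr0 !scale0r.
by rewrite mulg1 mulr1 -mulrA santil.
Qed.

Lemma gamma_beta x h :
  gamma w x h h^-1%g * w (x^-1 * h * x)%g (x^-1 * h^-1 * x)%g (x^-1 * h * x)%g
    = w h h^-1%g h * gamma w x h^-1%g h.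
Proof.
have Eq := gamma_assoc w x h h^-1%g h.
rewrite !gsimp gammax1 gamma11 !mul1r in Eq.
by rewrite -Eq mulrC.
Qed.

Lemma dbl_beta g x :
  e g x * dbeta
    = w (x^-1 * g * x)%g (x^-1 * g^-1 * x)%g (x^-1 * g * x)%g *: e g x.
Proof.
rewrite /dbeta mulr_sumr (sum_delta (a := (x^-1 * g * x)%g)) => [|b ne].
  by rewrite -scalerAr dbl1r eqxx scale1r !gsimp.
by rewrite -scalerAr dbl1r (negPf ne) scale0r scaler0.
Qed.

Lemma dantipoder h :
  tlift (fun a b => a * dbeta * dantipode b) (dcomult h)
    = (dcounit h : k) *: dbeta.
Proof.
elim/dbl_ind: h => [c a b IH IH'|g x].
  by rewrite !linearP /= IH IH' scalerDl scalerA.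
have bi : bilin (fun a b : D => a * dbeta * dantipode b).
  split=> [b c a a'|a c b b'].
    by rewrite !mulrDl !scalerAl.
  by rewrite linearP mulrDr scalerAr.
rewrite dcomult_dbl [LHS]linear_sum dcounit_dbl /= scaler_sumr.
apply: eq_bigr => a _.
rewrite [LHS]linearZ /= tlift_tens // dantipode_dbl dbl_beta -scalerAl.
rewrite -scalerAr dblM.
have -> : (a == x * (x^-1 * (a^-1 * g)^-1 * x) * x^-1)%g = (g == 1%g).
  rewrite !gsimp -{1}[a]mul1g (inj_eq (mulIg a)).
  by rewrite -[in RHS](inj_eq invg_inj) invg1 eq_sym.
case: (g =P _) => [->|_]; last by rewrite !(mulr0, scale0r, scaler0).
rewrite mulg1 mulgV mulr1 scale1r !scalerA; congr (_ *: _).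
rewrite gamma_beta /santi invgK.
by field; rewrite theta_neq0 gamma_neq0.
Qed.

Lemma dbeta_dbl1 g : e g 1%g * dbeta = w g g^-1%g g *: e g 1%g.
Proof. by rewrite dbl_beta invg1 !mul1g !mulg1. Qed.

Lemma tlift3_diag3 (V : vectType k) (F : D -> D -> D -> V) f :
  (forall b c, linear (fun a => F a b c)) ->
  (forall a c, linear (fun b => F a b c)) ->
  (forall a b, linear (fun c => F a b c)) ->
  tlift3 F (diag3 f)
    = \sum_a \sum_b \sum_c f a b c *: F (e a 1%g) (e b 1%g) (e c 1%g).
Proof.
move=> l1 l2 l3; rewrite [LHS]linear_sum; apply: eq_bigr => a _.
rewrite [LHS]linear_sum; apply: eq_bigr => b _.
rewrite [LHS]linear_sum; apply: eq_bigr => c _.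
by rewrite [LHS]linearZ /= tlift3_tens.
Qed.

Lemma dantipode_associator :
  tlift3 (fun x y z => x * dbeta * dantipode y * 1 * z) dassociator = 1.
Proof.
rewrite dassociatorE tlift3_diag3; last 3 first.
- by move=> *; move=> ? ? ?; rewrite !mulrDl !scalerAl.
- by move=> *; move=> ? ? ?; rewrite !mulr1 linearP mulrDr mulrDl -scalerAr -scalerAl.
- by move=> *; move=> ? ? ?; rewrite mulrDr scalerAr.
rewrite dbl1; apply: eq_bigr => a _.
rewrite (sum_delta (a := a^-1%g)) => [|b ne]; last first.
  apply: big1 => c _; rewrite dbeta_dbl1 dantipode_dbl1 mulr1 -scalerAl dbl1l.
  rewrite (_ : (a == _) = false) ?(scale0r, scaler0, mul0r) //.
  by apply: contraNF ne => /eqP->; rewrite invgK.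
rewrite (sum_delta (a := a)) => [|c ne]; rewrite dbeta_dbl1 dantipode_dbl1 invgK
    mulr1 -!scalerAl !dbl1l eqxx !scale1r dbl1l.
  by rewrite eqxx scale1r scalerA mulVf ?scale1r.
by rewrite eq_sym (negPf ne) scale0r !scaler0.
Qed.

Lemma dantipode_associatorV :
  tlift3 (fun x y z => dantipode x * 1 * y * dbeta * dantipode z)
    dassociator^-1 = 1.
Proof.
rewrite dassociatorV tlift3_diag3; last 3 first.
- by move=> *; move=> ? ? ?; rewrite linearP !mulrDl !scalerAl.
- by move=> *; move=> ? ? ?; rewrite mulrDr !mulrDl -scalerAr -!scalerAl.
- by move=> *; move=> ? ? ?; rewrite linearP mulrDr scalerAr.
rewrite dbl1 (reindex_inj invg_inj); apply: eq_bigr => a _.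
rewrite (sum_delta (a := a)) => [|b ne]; last first.
  apply: big1 => c _; rewrite dantipode_dbl1 invgK mulr1 dbl1l.
  by rewrite eq_sym (negPf ne) !(scale0r, mul0r, scaler0).
rewrite dantipode_dbl1 invgK mulr1 dbl1l eqxx scale1r dbeta_dbl1.
rewrite (sum_delta (a := a^-1%g)) => [|c ne].
  rewrite dantipode_dbl1 invgK -scalerAl dbl1l eqxx scale1r scalerA.
  by rewrite mulrC w_inv scale1r.
rewrite dantipode_dbl1 -scalerAl dbl1l (_ : (a == _) = false).
  by rewrite scale0r !scaler0.
by apply: contraNF ne => /eqP->; rewrite invgK.
Qed.

Definition twisted_double_quasiHopf : quasiHopf D :=
  @QuasiHopf k D dcomult dcounit dassociator 1 dbeta dantipode
    dcounitl dcounitr dassociator_unit dquasi_coassoc dpentagon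
    dassociator_counit dantipode1 dantipodeM dantipode_bij dantipodel dantipoder
    dantipode_associator dantipode_associatorV.

Lemma twisted_double_integral : (#|gT|%:R : k) != 0 ->
  normalized_integral twisted_double_quasiHopf
    ((#|gT|%:R)^-1 *: \sum_x e 1%g x).
Proof.
move=> n0; split=> [h|h|] /=.
- rewrite -scalerAr scalerA mulrC -scalerA; congr (_ *: _).
  elim/dbl_ind: h => [c a b IH IH'|g x].
    by rewrite mulrDl -scalerAl !linearP /= IH IH' scalerDl scalerA.
  rewrite dcounit_dbl mulr_sumr scaler_sumr [in RHS](reindex_inj (mulgI x)) /=.
  apply: eq_bigr => y _; rewrite dblM mulg1 mulgV.
  by case: (g =P _) => [->|_]; rewrite ?theta11 ?mulr1 ?mulr0 ?scale0r.
- rewrite -scalerAl scalerA mulrC -scalerA; congr (_ *: _).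
  elim/dbl_ind: h => [c a b IH IH'|g x].
    by rewrite mulrDr -scalerAr !linearP /= IH IH' scalerDl scalerA.
  rewrite dcounit_dbl mulr_suml scaler_sumr [in RHS](reindex_inj (mulIg x)) /=.
  apply: eq_bigr => y _; rewrite dblM theta11 mul1r.
  congr ((nat_of_bool _)%:R *: _).
  by rewrite -(inj_eq (mulgI y^-1%g)) -(inj_eq (mulIg y)) !gsimp eq_sym.
rewrite linearZ linear_sum /=.
under eq_bigr do rewrite dcounit_dbl eqxx.
by rewrite sumr_const; apply: mulVf.
Qed.

End DoubleStructure.

(* Main.v *)
(** The scalars of [q_L] and [p_L] are such that in [q_L * Delta(Lambda) * p_L]
    the factor [w(b^-1, b, b^-1)] contributed by [beta] to [p_L] cancels against
    [Phi] at [b = x^-1 g x], because both legs of [Delta(Lambda)] carry inverse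
    elements of [G]. What remains is the factor [w(g^-1, g, g^-1)] of [q_L], and
    multiplying the two legs [e(g) (x) x] and [e(g^-1) (x) x] yields
    [theta_g(x, x)] and the condition [x^-1 g x = g^-1]. The resulting expression
    for [nu] holds in [D^w(G)] itself, so only the linearity of characters is
    used. *)

From HB Require Import structures.
Require Import Defs.
From mathcomp Require Import all_boot all_order all_fingroup all_algebra all_field.
From Stdlib Require Import ClassicalEpsilon.

Set Implicit Arguments.
Unset Strict Implicit.
Unset Printing Implicit Defensive.

Import GRing.Theory.
Local Open Scope ring_scope.

(** [integral] is picked by [epsilon], so it can be computed only through uniqueness, once an
    explicit [L] is exhibited. *)
Lemma integral_eq (k : fieldType) (H : falgType k) (Q : quasiHopf H) (L : H) :
  normalized_integral Q L -> integral Q = L.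
Proof.
move=> hL; apply: (@normalized_integral_uniq _ _ Q) => //.
by apply: epsilon_spec; exists L.
Qed.

Lemma irreducible_character_linear (k : fieldType) (H : falgType k)
  (chi : H -> k) : irreducible_character chi -> linear (chi : H -> k^o).
Proof. by case=> n [rho [_ chiE]] c a b; rewrite !chiE linearP mxtraceD mxtraceZ. Qed.

Lemma mulmap_bilin (k : fieldType) (A : falgType k) : bilin (@GRing.mul A).
Proof.
by split=> [b c a a'|a c b b']; rewrite ?mulrDl ?mulrDr -?scalerAl -?scalerAr.
Qed.

Lemma mulr_sum2 (R : nzRingType) (I J : finType) (F : I -> J -> R) a b :
  a * (\sum_i \sum_j F i j) * b = \sum_i \sum_j a * F i j * b.
Proof.
rewrite mulr_sumr mulr_suml; apply: eq_bigr => i _.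
by rewrite mulr_sumr mulr_suml.
Qed.

Section TwistedDouble.
Variables (gT : finGroupType) (k : fieldType) (w : cocycle3 gT k).
Local Notation D := (twisted_double w).
Local Notation Q := (twisted_double_quasiHopf w).
Local Notation e := (dbl w).

Definition diag2 (f : gT -> gT -> k) : D \otimes D :=
  \sum_a \sum_b f a b *: (e a 1%g \ot e b 1%g).

Lemma diag2l f a b x y :
  diag2 f * (e a x \ot e b y) = f a b *: (e a x \ot e b y).
Proof.
rewrite /diag2 mulr_suml (sum_delta (a := a)) => [|a' /negPf ne]; last first.
  rewrite mulr_suml big1 // => ? _.
  by rewrite -scalerAl !tensM dbl1l ne scale0r !tens0l scaler0.
rewrite mulr_suml (sum_delta (a := b)) => [|b' /negPf ne].
  by rewrite -scalerAl !tensM !dbl1l !eqxx !scale1r.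
by rewrite -scalerAl !tensM !dbl1l ne scale0r tens0r scaler0.
Qed.

(** [e a x * e a' 1] survives only for [a' = x^-1 a x], whence the conjugated arguments of [f]. *)
Lemma diag2r f a b x y :
  (e a x \ot e b y) * diag2 f
    = f (x^-1 * a * x)%g (y^-1 * b * y)%g *: (e a x \ot e b y).
Proof.
rewrite /diag2 mulr_sumr (sum_delta (a := (x^-1 * a * x)%g)) => [|a' /negPf ne];
    last first.
  rewrite mulr_sumr big1 // => ? _.
  by rewrite -scalerAr !tensM dbl1r ne scale0r !tens0l scaler0.
rewrite mulr_sumr (sum_delta (a := (y^-1 * b * y)%g)) => [|b' /negPf ne].
  by rewrite -scalerAr !tensM !dbl1r !eqxx !scale1r.
by rewrite -scalerAr !tensM !dbl1r ne scale0r tens0r scaler0.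
Qed.

Lemma dantipodeV_dbl1 g : (dantipode w)^-1%VF (e g 1%g) = e g^-1%g 1%g.
Proof.
rewrite -{1}[g]invgK -(dantipode_dbl1 w g^-1%g) lker0_lfunK //.
(* The inverse [^-1%VF] cancels on the left only because the antipode has trivial kernel. *)
by apply/lker0P/bij_inj/dantipode_bij.
Qed.

(** Since [alpha] is 1 and the antipode sends [e a 1] to [e a^-1 1], orthogonality of these
    idempotents forces [b = a^-1] and removes one of the three sums. *)
Lemma dq_LE : q_L Q = diag2 (fun b c => w b^-1%g b c).
Proof.
rewrite /q_L /= dassociatorV tlift3_diag3; last 3 first.
- by move=> *; move=> ? ? ?; rewrite linearP !mulrDl -!scalerAl tens_linl.
- by move=> *; move=> ? ? ?; rewrite mulrDr -scalerAr tens_linl.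
- by move=> *; move=> ? ? ?; rewrite tens_linr.
rewrite [RHS](reindex_inj invg_inj); apply: eq_bigr => a _ /=.
rewrite (sum_delta (a := a^-1%g)) => [|b ne].
  apply: eq_bigr => c _.
  by rewrite dantipode_dbl1 mulr1 dbl1l eqxx scale1r invgK.
apply: big1 => c _; rewrite dantipode_dbl1 mulr1 dbl1l eq_sym (negPf ne).
by rewrite scale0r tens0l scaler0.
Qed.

(** The same collapse to [a = b^-1]: the numerator is the coefficient of [beta] at [b^-1], the
    denominator that of the associator. *)
Lemma dp_LE :
  p_L Q = diag2 (fun b c => w b^-1%g b b^-1%g / w b^-1%g b c).
Proof.
rewrite /p_L /= dassociatorE tlift3_diag3; last 3 first.
- move=> *; move=> ? ? ?.
  by rewrite mulrDl -scalerAl linearP mulrDr -scalerAr tens_linl.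
- by move=> *; move=> ? ? ?; rewrite mulrDl -scalerAl tens_linl.
- by move=> *; move=> ? ? ?; rewrite tens_linr.
rewrite [RHS](reindex_inj invg_inj); apply: eq_bigr => a _ /=.
rewrite (sum_delta (a := a^-1%g)) => [|b ne].
  apply: eq_bigr => c _.
  rewrite dbeta_dbl1 linearZ /= dantipodeV_dbl1 -scalerAr dbl1l eqxx scale1r.
  by rewrite tensZl scalerA invgK mulrC.
apply: big1 => c _; rewrite dbeta_dbl1 linearZ /= dantipodeV_dbl1 -scalerAr.
by rewrite dbl1l (negPf ne) scale0r scaler0 tens0l scaler0.
Qed.

Lemma dFS_nuE : (#|gT|%:R : k) != 0 ->
  FS_nu Q = (#|gT|%:R)^-1 *:
    \sum_(g : gT) \sum_(x : gT | (x^-1 * g * x == g^-1)%g)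
      (w g^-1%g g g^-1%g * gamma w x g g^-1%g * theta w g x x)
        *: e g (x ^+ 2)%g.
Proof.
move=> n0; rewrite /FS_nu (integral_eq (twisted_double_integral w n0)).
(* The integral is supported on [e 1 x], so the two legs carry labels with product 1. *)
have -> : comult Q ((#|gT|%:R)^-1 *: \sum_x e 1%g x) = (#|gT|%:R)^-1 *:
    \sum_x \sum_g gamma w x g g^-1%g *: (e g x \ot e g^-1%g x).
  rewrite linearZ linear_sum; congr (_ *: _); apply: eq_bigr => x _ /=.
  by rewrite dcomult_dbl; apply: eq_bigr => g _; rewrite mulg1.
rewrite dq_LE dp_LE -scalerAr -scalerAl [LHS]linearZ; congr (_ *: _).
rewrite mulr_sum2 exchange_big [LHS]linear_sum; apply: eq_bigr => g _.
rewrite [LHS]linear_sum [RHS]big_mkcond; apply: eq_bigr => x _.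
rewrite -scalerAr diag2l scalerA -scalerAl diag2r scalerA.
rewrite [LHS]linearZ /= tlift_tens; last exact: mulmap_bilin.
have -> : (x^-1 * g^-1 * x = (x^-1 * g * x)^-1)%g.
  by rewrite !invMg invgK mulgA.
rewrite divff ?cocycle3_neq0 // mulr1 dblM scalerA expgS expg1.
have -> : ((g == x * g^-1 * x^-1) = (x^-1 * g * x == g^-1))%g.
  by rewrite -[RHS](inj_eq (mulgI x)) -[RHS](inj_eq (mulIg x^-1%g)) !mulgA
    mulgV mul1g mulgK.
case: ifP => _; last by rewrite !mulr0 scale0r.
by rewrite mulr1 [gamma _ _ _ _ * _]mulrC.
Qed.

End TwistedDouble.

Theorem mainTheorem4 (k : fieldType) (gT : finGroupType)
    (hG : (#|gT|%:R : k) \is a GRing.unit) (w : cocycle3 gT k)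
    (chi : twisted_double w -> k) (hchi : irreducible_character chi) :
  chi (FS_nu (twisted_double_quasiHopf w)) =
    (#|gT|%:R)^-1 *
      \sum_(g : gT) \sum_(x : gT | (x^-1 * g * x == g^-1)%g)
        w g^-1%g g g^-1%g * gamma w x g g^-1%g * theta w g x x
          * chi (dbl w g (x ^+ 2)%g).
Proof.
rewrite unitfE in hG; rewrite dFS_nuE //.
pose F := GRing.isLinear.Build k _ k^o _ chi (irreducible_character_linear hchi).
(* [chi] is a bare function; bundling it gives access to the lemmas on linear maps. *)
pose f : {linear twisted_double w -> k^o} := HB.pack chi F.
rewrite -[chi]/(f : _ -> _) linearZ linear_sum; congr (_ * _).
apply: eq_bigr => g _; rewrite linear_sum; apply: eq_bigr => x _.
by rewrite linearZ.
Qed.
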